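(* Let $d\in\mathbb{N}$ with $d\ge 1$, and let $g, f_1, f_2, \dots$ be probability densities on $\mathbb{R}^d$ (with respect to Lebesgue measure) with corresponding probability distributions $G, F_1, F_2, \dots$. For each $j\in\mathbb{N}$, assume that the pair $(F_j,G)$ is TV-regular, and let $A_j := A(f_j,g)$ be a closed set with $d_{TV}(F_j,G)=F_j(A_j)-G(A_j)$ (arbitrarily chosen among such sets). Suppose that, for some $\varepsilon>0$, (i) $d_{TV}(F_j,G)\ge\varepsilon$ for all $j\in\mathbb{N}$, and (ii) $d_w(F_j,G)\to 0$ as $j\to\infty$. Then, for any sequence $(\delta_j)_{j\in\mathbb{N}}$ of real numbers with $\delta_j>d_w(F_j,G)$ for all $j$ and $\lim_{j\to\infty}\delta_j=0$, there exists a sequence $(t_j)_{j\in\mathbb{N}}$ with $t_j\in(0,\delta_j)$ for all $j$ such that $$\lim_{j\to\infty}\mathcal{H}^{d-1}\bigl(P_{t_j}(f_j,g)\bigr)=\infty,\qquad\text{where } P_{t}(f_j,g)=\{x\in\mathbb{R}^d : d_{A_j}(x)=t\}.$$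
   Context: Total variation distance: $d_{TV}(F,G):=\sup_{A\in\mathcal{B}(\mathbb{R}^d)}|F(A)-G(A)|$, where $\mathcal{B}(\mathbb{R}^d)$ is the Borel $\sigma$-algebra. For $A\subseteq\mathbb{R}^d$, $d_A(x):=\inf_{y\in A}|x-y|$ is the Euclidean distance to $A$, and $A^\delta:=\{x\in\mathbb{R}^d: d_A(x)<\delta\}$ for $\delta>0$. Lévy–Prokhorov distance: $d_w(F,G):=\inf\{\delta>0: F(A)\le G(A^\delta)+\delta \text{ and } G(A)\le F(A^\delta)+\delta \text{ for all } A\in\mathcal{B}(\mathbb{R}^d)\}$. TV-regular: a pair $(F,G)$ of probability measures on $\mathbb{R}^d$ is TV-regular if there exists a closed set $A\subseteq\mathbb{R}^d$ with $d_{TV}(F,G)=F(A)-G(A)$. When $F,G$ have densities $f,g$, $A(f,g)$ denotes one such closed set, arbitrarily chosen. Passing set: for $t>0$, $P_t(f,g):=\{x\in\mathbb{R}^d: d_{A(f,g)}(x)=t\}$. Hausdorff measure (unnormalized): for $r\ge0$, $\mathcal{H}^r(E):=\lim_{\delta\to0}\inf\{\sum_{i=1}^\infty(\operatorname{diam}U_i)^r: E\subseteq\bigcup_{i=1}^\infty U_i,\ \operatorname{diam}U_i<\delta\}$, the infimum being over countable covers; $\mathcal{H}^0$ is the counting measure. *)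

(* Defs.v *)
From HB Require Import structures.
From mathcomp Require Import all_boot all_order all_algebra.
From mathcomp Require Import all_classical all_reals all_analysis.
From mathcomp Require Import measurable_realfun.

Set Implicit Arguments.
Unset Strict Implicit.
Unset Printing Implicit Defensive.

Import Order.TTheory GRing.Theory Num.Theory.
Import numFieldNormedType.Exports.

Local Open Scope classical_set_scope.
Local Open Scope ring_scope.

(* The row vectors 'rV[R]_d with the sigma-algebra generated by the open sets
   of the product topology. It is convertible to 'rV[R]_d, which carries the
   topology; the library norm on 'rV[R]_d is the sup norm and is not used to
   measure distances here. *)
Definition borel_rV (R : realType) (d : nat) :=
  g_sigma_algebraType (@open 'rV[R]_d).

Section euclidean.
Variables (R : realType) (d : nat).
Implicit Types (x y : 'rV[R]_d) (A : set 'rV[R]_d).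

Definition edist x y : R := Num.sqrt (\sum_(i < d) (x 0 i - y 0 i) ^+ 2).

(* Extended-real valued, so that set_dist set0 x = +oo. *)
Definition set_dist A x : \bar R := ereal_inf [set (edist x y)%:E | y in A].

Definition thickening A (delta : R) : set 'rV[R]_d :=
  [set x | (set_dist A x < delta%:E)%E].

Definition passing_set A (t : R) : set 'rV[R]_d :=
  [set x | set_dist A x = t%:E].

(* The supremum over set0 is -oo, whence the maximum with 0. *)
Definition ediam A : \bar R :=
  maxe 0%E (ereal_sup [set (edist z.1 z.2)%:E | z in A `*` A]).

(* (diam U)^r, with the usual conventions 0^0 = 1 for a nonempty U and
   (diam set0)^0 = 0, which make the 0-dimensional measure count points. *)
Definition diam_pow (r : R) (U : set 'rV[R]_d) : \bar R :=
  if U == set0 then 0%E else poweR (ediam U) r.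

Definition hausdorff_content (r delta : R) (E : set 'rV[R]_d) : \bar R :=
  ereal_inf [set (\sum_(0 <= i <oo) diam_pow r (U i))%E
            | U in [set U : nat -> set 'rV[R]_d |
                E `<=` \bigcup_i U i /\
                forall i, (ediam (U i) < delta%:E)%E]].

Definition hausdorff_measure (r : R) (E : set 'rV[R]_d) : \bar R :=
  lim (hausdorff_content r delta E @[delta --> 0^'+]).

Lemma hausdorff_content_le r E (d1 d2 : R) : d1 <= d2 ->
  (hausdorff_content r d2 E <= hausdorff_content r d1 E)%E.
Proof.
move=> d12; apply: ereal_inf_le_tmp => _ [U [EU Ud] <-].
by exists U => //; split => // i; rewrite (lt_le_trans (Ud i))// lee_fin.
Qed.

Lemma cvg_hausdorff_measure r E :
  hausdorff_content r delta E @[delta --> 0^'+] --> hausdorff_measure r E.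
Proof.
apply: nonincreasing_at_right_is_cvge; near=> x => y z _ _ yz.
exact: hausdorff_content_le.
Unshelve. all: by end_near. Qed.

End euclidean.

Section lebesgue.
Variable R : realType.

Lemma coord_measurable d (i : 'I_d) :
  measurable_fun setT (fun x : borel_rV R d => (x : 'rV[R]_d) 0 i).
Proof.
apply: (measurability _ (RGenOInfty.measurableE R)) => // _ [_ [a ->] <-].
rewrite setTI; apply: sub_sigma_algebra.
apply: (@open_comp 'rV[R]_d R (fun x => x 0 i)) => [x _|].
  exact: coord_continuous.
exact: interval_open.
Qed.

Lemma measurable_rVP d disp (T : measurableType disp) (f : T -> borel_rV R d) :
  (forall i, measurable_fun setT (fun x => (f x : 'rV[R]_d) 0 i)) ->
  measurable_fun setT f.
Proof.
move=> mf.
apply: (@measurability _ _ _ _ _ f (@open 'rV[R]_d) erefl) => _ [U oU <-].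
rewrite setTI.
pose box (q : 'rV[rat]_d) (k : nat) : set 'rV[R]_d :=
  [set y | forall i, `|ratr (q 0 i) - y 0 i| < k.+1%:R^-1].
have mbox q k : measurable (f @^-1` box q k).
  rewrite (_ : _ @^-1` _ = \bigcap_(i in [set: 'I_d])
      ((fun x => (f x : 'rV[R]_d) 0 i) @^-1` ball (ratr (q 0 i) : R) k.+1%:R^-1)).
    apply: fin_bigcap_measurable => // i _; rewrite -[X in measurable X]setTI.
    by apply: mf => //; exact: measurable_ball.
  by apply/seteqP; split => x /= bx i; [move=> _|]; apply: bx.
pose W n := if unpickle n is Some (q, k) then
  if pselect (box q k `<=` U) then f @^-1` box q k else set0 else set0.
rewrite (_ : _ @^-1` U = \bigcup_n W n); last first.
  apply/seteqP; split => [x Ux|x [n _]]; last first.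
    rewrite /W; case: unpickle => // -[q k]; case: pselect => // qU /=.
    exact: qU.
  have /nbhs_ballP[e /= e0 eU] : nbhs (f x : 'rV[R]_d) U by exact: open_nbhs_nbhs.
  have [k ke] : exists k, k.+1%:R^-1 < e / 2.
    have e20 : 0 < e / 2 by rewrite divr_gt0.
    near \oo => k; exists k; near: k.
    exact: near_infty_natSinv_lt (PosNum e20).
  have kx i : exists q : rat, `|ratr q - (f x : 'rV[R]_d) 0 i| < k.+1%:R^-1.
    have : (f x : 'rV[R]_d) 0 i - k.+1%:R^-1 < (f x : 'rV[R]_d) 0 i + k.+1%:R^-1.
      by rewrite ltrBlDr -addrA ltrDl addr_gt0// invr_gt0.
    move=> /rat_in_itvoo[q]; rewrite in_itv/= => /andP[q1 q2].
    by exists q; rewrite ltr_distl q1 q2.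
  have [q qx] := choice kx.
  pose Q := \row_i q i.
  exists (pickle (Q, k)) => //; rewrite /W pickleK.
  have QU : box Q k `<=` U.
    move=> y Qy; apply: eU; split => // i j; rewrite (ord1 i) -ball_normE/=.
    have := qx j; have := Qy j; rewrite /Q mxE => h1 h2.
    rewrite (_ : _ - _ = ((f x : 'rV[R]_d) 0 j - ratr (q j)) + (ratr (q j) - y 0 j));
      last by rewrite addrA subrK.
    rewrite (le_lt_trans (ler_normD _ _))// (splitr e) ltrD//.
      by rewrite distrC (lt_trans h2).
    exact: lt_trans ke.
  by case: pselect => //= _ i; rewrite /Q mxE; exact: qx.
apply: bigcupT_measurable => n; rewrite /W.
case: unpickle => [[q k]|]; last exact: measurable0.
by case: pselect => ?; [exact: mbox|exact: measurable0].
Unshelve. all: by end_near. Qed.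

Definition rV_cons d (p : R * borel_rV R d) : borel_rV R d.+1 :=
  row_mx (const_mx p.1 : 'rV_1) (p.2 : 'rV_d).

Definition rV_uncons d (x : borel_rV R d.+1) : R * borel_rV R d :=
  ((x : 'rV_d.+1) 0 0, rsubmx (x : 'rV_(1 + d))).

Lemma measurable_rV_cons d : measurable_fun setT (@rV_cons d).
Proof.
apply: measurable_rVP => i; case: (@split_ordP 1 d i) => j ->.
  rewrite (_ : (fun _ => _) = fst); first exact: measurable_fst.
  by apply/funext => p; rewrite [LHS]row_mxEl mxE.
rewrite (_ : (fun _ => _) = (fun x : borel_rV R d => (x : 'rV_d) 0 j) \o snd).
  exact: (measurableT_comp (coord_measurable j) measurable_snd).
by apply/funext => p; rewrite [LHS]row_mxEr.
Qed.

Lemma measurable_rV_uncons d : measurable_fun setT (@rV_uncons d).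
Proof.
apply/measurable_fun_pairP; split; first exact: coord_measurable.
apply: measurable_rVP => i; rewrite /comp/=.
under eq_fun do rewrite mxE.
exact: (@coord_measurable d.+1).
Qed.

Lemma rV_consK d : cancel (@rV_cons d) (@rV_uncons d).
Proof.
move=> [a x]; rewrite /rV_uncons /rV_cons/= row_mxKr; congr pair.
transitivity (row_mx (const_mx a : 'rV_1) (x : 'rV_d) 0 (lshift d ord0)).
  by congr (row_mx _ _ _ _); exact: val_inj.
by rewrite row_mxEl mxE.
Qed.

Section lebesgue_rV_succ.
Variables (d : nat) (mu : {sigma_finite_measure set (borel_rV R d) -> \bar R}).

Definition lebesgue_rV_succ : set (borel_rV R d.+1) -> \bar R :=
  pushforward (@lebesgue_measure R \x mu)%E (@rV_cons d).

Let nu : {measure set (borel_rV R d.+1) -> \bar R} :=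
  measure_function_pushforward__canonical__measure_function_Measure
    (@lebesgue_measure R \x mu)%E (@measurable_rV_cons d).

HB.instance Definition _ := isMeasure.Build _ _ _ lebesgue_rV_succ
  (measure0 nu) (measure_ge0 nu) (@measure_semi_sigma_additive _ _ _ nu).

Let lebesgue_rV_succ_sigma_finite : sigma_finite setT lebesgue_rV_succ.
Proof.
have /sigma_finiteP[F [FT ndF Foo]] := sigma_finiteT (@lebesgue_measure R).
have /sigma_finiteP[G [GT ndG Goo]] := sigma_finiteT mu.
exists (fun n => @rV_uncons d @^-1` (F n `*` G n)) => [|n].
  rewrite -preimage_bigcup (_ : \bigcup_n _ = setT) ?preimage_setT//.
  apply/seteqP; split => // -[x y] _.
  have [/= m _ Fx] : (\bigcup_i F i) x by rewrite -FT.
  have [/= n _ Gy] : (\bigcup_i G i) y by rewrite -GT.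
  exists (maxn m n) => //; split => /=.
    by move: x Fx; exact/subsetPset/ndF/leq_maxl.
  by move: y Gy; exact/subsetPset/ndG/leq_maxr.
have [[mF Fn] [mG Gn]] := (Foo n, Goo n); split.
  by rewrite -[X in measurable X]setTI; apply: measurable_rV_uncons => //;
     exact: measurableX.
rewrite /lebesgue_rV_succ /pushforward -comp_preimage.
rewrite (_ : _ \o _ = id); last by apply/funext => x; exact: rV_consK.
by rewrite preimage_id product_measure1E// lte_mul_pinfty// ge0_fin_numE.
Qed.

HB.instance Definition _ := Measure_isSigmaFinite.Build _ _ _
  lebesgue_rV_succ lebesgue_rV_succ_sigma_finite.

End lebesgue_rV_succ.

(* Lebesgue measure on the Borel sets of R^d as a d-fold product measure. *)
Fixpoint lebesgue_rV (d : nat) :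
    {sigma_finite_measure set (borel_rV R d) -> \bar R} :=
  match d with
  | 0 => dirac ((0 : 'rV[R]_0) : borel_rV R 0)
  | d'.+1 => lebesgue_rV_succ (lebesgue_rV d')
  end.

Lemma lebesgue_rV_box d (a b : 'rV[R]_d) : (forall i, a 0 i <= b 0 i) ->
  lebesgue_rV d ([set x : 'rV[R]_d | forall i, a 0 i < x 0 i <= b 0 i]
    : set (borel_rV R d)) =
  (\prod_(i < d) (b 0 i - a 0 i))%:E.
Proof.
elim: d a b => [|d IH] a b ab.
  by rewrite big_ord0 /= diracE mem_set// => -[].
pose a' : 'rV[R]_d := \row_i a 0 (lift ord0 i).
pose b' : 'rV[R]_d := \row_i b 0 (lift ord0 i).
pose B : set (borel_rV R d) :=
  [set x : 'rV[R]_d | forall i, a' 0 i < x 0 i <= b' 0 i].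
have mB : measurable B.
  rewrite (_ : B = \bigcap_(i in [set: 'I_d]) ((fun x : borel_rV R d =>
      (x : 'rV_d) 0 i) @^-1` `]a' 0 i, b' 0 i]%classic)).
    apply: fin_bigcap_measurable => // i _; rewrite -[X in measurable X]setTI.
    by apply: coord_measurable => //; exact: measurable_itv.
  by apply/seteqP; split=> x Bx i; [move=> _|]; have := Bx i; rewrite /= in_itv/=;
    [|exact].
rewrite /= /lebesgue_rV_succ /pushforward.
rewrite (_ : _ @^-1` _ = `]a 0 ord0, b 0 ord0]%classic `*` B); last first.
  have E0 y (x : 'rV[R]_d) : (rV_cons (y, x) : 'rV_d.+1) 0 ord0 = y.
    exact: (congr1 fst (rV_consK (y, x))).
  have E1 y (x : 'rV[R]_d) i : (rV_cons (y, x) : 'rV_d.+1) 0 (lift ord0 i) = x 0 i.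
    transitivity (row_mx (const_mx y : 'rV_1) x 0 (rshift 1 i)).
      by congr (row_mx _ _ _ _); exact: val_inj.
    by rewrite row_mxEr.
  apply/seteqP; split => -[y x] /=.
    move=> H; split; first by have := H ord0; rewrite E0 in_itv.
    by move=> i; have := H (lift ord0 i); rewrite E1 !mxE.
  move=> [yab xB] i; case: (unliftP ord0 i) => [j|] ->; last first.
    by move: yab; rewrite E0 in_itv.
  by have := xB j; rewrite E1 !mxE.
rewrite product_measure1E//.
rewrite (IH a' b'); last by move=> i; rewrite !mxE.
rewrite [X in (X * _)%E]lebesgue_measure_itv/= lte_fin big_ord_recl EFinM.
congr (_ * _)%E; last by congr EFin; apply: eq_bigr => i _; rewrite !mxE.
case: ltP => [//|ba]; congr EFin.
by apply/esym/eqP; rewrite subr_eq0 eq_le ba ab.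
Qed.

End lebesgue.

Section probability_metrics.
Variables (R : realType) (d : nat).
Implicit Types (F G : probability (borel_rV R d) R).
Local Open Scope ereal_scope.

Definition is_density (f : borel_rV R d -> R) (F : probability (borel_rV R d) R) :=
  [/\ measurable_fun setT f, forall x, (0 <= f x)%R &
      forall A, measurable A -> F A = \int[lebesgue_rV R d]_(x in A) (f x)%:E].

Definition tv_dist F G : \bar R :=
  ereal_sup [set `|F A - G A| | A in measurable].

Definition levy_prokhorov F G : \bar R :=
  ereal_inf [set delta%:E | delta in [set delta : R | (0 < delta)%R /\
    forall A : set (borel_rV R d), measurable A ->
      F A <= G (thickening A delta) + delta%:E /\
      G A <= F (thickening A delta) + delta%:E]].

Definition tv_attained F G (A : set 'rV[R]_d) :=
  closed A /\ tv_dist F G = F A - G A.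

Definition tv_regular F G := exists A, tv_attained F G A.

End probability_metrics.

(* Main.v *)
Require Import Defs.
From mathcomp Require Import all_boot all_order all_algebra.
From mathcomp Require Import all_classical all_reals all_analysis.
From mathcomp Require Import ring lra.

(** Write S_j for the collar [A_j^delta_j \ A_j], the set of points at distance
in ]0, delta_j[ from [A_j].

The collars keep a fixed volume. Since [A_j] attains the total variation
distance and delta_j exceeds the Levy-Prokhorov distance,
[eps <= F_j A_j - G A_j <= G S_j + delta_j] ([collar_mass]). As G does not
depend on j and has a density, a G-mass of at least eps / 2 forces a Lebesgue
measure of at least some eta > 0 not depending on j
([density_abs_continuous]).

A thin collar of fixed volume has a large level set. If every level set [P_t],
0 < t < delta, had H^(d-1)-measure below M, the collar would have volume at
most C M delta, with C depending only on d ([collar_le]). Hence some [P_t] has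
measure at least eta / (2 C delta_j), and this bound tends to infinity with
delta_j -> 0 ([passing_set_large]).

The volume bound replaces the coarea formula. Consider the shell of points x
whose distance D to A lies in [[2s, 4s]], and let y be a nearest point of A to
x. The point z of the segment from y to x at distance s from y lies on [P_s],
and x is determined by D and by z with its direction u = (x - y) / D. The
direction is (1/s)-Lipschitz in z: the ball around x of radius D avoids A on
one side of z, a point of A lies at distance s on the other side, and
comparing two such configurations gives [s |u - u'| <= |z - z'|]
([foot_direction_Lipschitz]). So x is a Lipschitz function of (z, D), with
constants free of s and A ([foot_coord_Lipschitz]). A set of diameter at most
l covering part of [P_s] therefore accounts for about 2s / l pieces of the
shell, each contained in a cube of side comparable to l, that is a volume of
order s l^(d-1) ([shell_over_le]). Summing over a cover of [P_s] gives a shell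
volume of order s H^(d-1)(P_s) ([shell_le]), and the shells at the dyadic
scales s = delta / 2^(k+2) exhaust the collar with a total of order M delta. *)

Set Implicit Arguments.
Unset Strict Implicit.
Unset Printing Implicit Defensive.

Import Order.TTheory GRing.Theory Num.Theory.
Import numFieldNormedType.Exports.
Local Open Scope classical_set_scope.
Local Open Scope ring_scope.

Local Notation edist := Defs.edist.

(** * Euclidean distance and nearest points *)

Section euclidean_distance.
Variables (R : realType) (d : nat).
Implicit Types (x y z w : 'rV[R]_d) (A : set 'rV[R]_d).

Lemma edist_ge0 x y : 0 <= edist x y.
Proof. exact: sqrtr_ge0. Qed.

Lemma edistC x y : edist x y = edist y x.
Proof. by congr Num.sqrt; apply: eq_bigr => i _; ring. Qed.

Lemma sqr_edist x y : edist x y ^+ 2 = \sum_(i < d) (x 0 i - y 0 i) ^+ 2.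
Proof. by rewrite sqr_sqrtr// sumr_ge0// => i _; exact: sqr_ge0. Qed.

Lemma le_edistE x y z w : (edist x y <= edist z w) =
  (\sum_(i < d) (x 0 i - y 0 i) ^+ 2 <= \sum_(i < d) (z 0 i - w 0 i) ^+ 2).
Proof. by rewrite ler_sqrt// sumr_ge0// => i _; exact: sqr_ge0. Qed.

Lemma le_coord_edist x y i : `|x 0 i - y 0 i| <= edist x y.
Proof.
rewrite -(ler_pXn2r (ltn0Sn 1)) ?nnegrE ?edist_ge0// sqr_edist real_normK ?num_real//.
by rewrite (bigD1 i)//= lerDl sumr_ge0// => j _; exact: sqr_ge0.
Qed.

Lemma edist_eq0 x y : edist x y = 0 -> x = y.
Proof.
move=> xy; apply/rowP => i; apply/eqP; rewrite -subr_eq0 -normr_le0.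
by have := le_coord_edist x y i; rewrite xy.
Qed.

Lemma Cauchy_Schwarz_sum (p q : 'I_d -> R) :
  (\sum_i p i * q i) ^+ 2 <= (\sum_i p i ^+ 2) * (\sum_i q i ^+ 2).
Proof.
have sqrE (a b : R) : \sum_i (a * p i - b * q i) ^+ 2 =
    a ^+ 2 * (\sum_i p i ^+ 2) - 2 * a * b * (\sum_i p i * q i)
      + b ^+ 2 * (\sum_i q i ^+ 2).
  rewrite !mulr_sumr -sumrB -big_split/=.
  by apply: eq_bigr => i _; ring.
(* Cauchy-Schwarz from the nonnegative quadratic form at a = Q and b = S. *)
set S := \sum_i p i * q i; set P := \sum_i p i ^+ 2; set Q := \sum_i q i ^+ 2.
have Q0 : 0 <= Q by apply: sumr_ge0 => i _; exact: sqr_ge0.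
have : 0 <= Q * (P * Q - S ^+ 2).
  suff <- : \sum_i (Q * p i - S * q i) ^+ 2 = Q * (P * Q - S ^+ 2).
    by apply: sumr_ge0 => i _; exact: sqr_ge0.
  by rewrite sqrE -/P -/S -/Q; ring.
have [Qp|] := ltP 0 Q; first by rewrite pmulr_rge0// subr_ge0.
move=> Qn _; have /eqP Qz : Q == 0 by rewrite eq_le Qn Q0.
have q0 i : q i = 0.
  have /eqP := Qz; rewrite psumr_eq0; last by move=> j _; exact: sqr_ge0.
  by move=> /allP/(_ i (mem_index_enum _)) /=; rewrite sqrf_eq0 => /eqP.
by rewrite /S big1 ?expr0n ?mulr_ge0//= ?sumr_ge0// => i _; rewrite ?q0 ?mulr0// sqr_ge0.
Qed.

Lemma edist_triangle y x z : edist x z <= edist x y + edist y z.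
Proof.
rewrite -(ler_pXn2r (ltn0Sn 1)) ?nnegrE ?addr_ge0 ?edist_ge0//.
have /(le_trans (ler_norm _)) CS :
    `|\sum_i (x 0 i - y 0 i) * (y 0 i - z 0 i)| <= edist x y * edist y z.
  rewrite -(ler_pXn2r (ltn0Sn 1)) ?nnegrE ?mulr_ge0 ?edist_ge0//.
  by rewrite exprMn !sqr_edist real_normK ?num_real// Cauchy_Schwarz_sum.
rewrite sqrrD !sqr_edist.
rewrite (_ : \sum_i (x 0 i - z 0 i) ^+ 2 =
  \sum_i (x 0 i - y 0 i) ^+ 2
  + (\sum_i (x 0 i - y 0 i) * (y 0 i - z 0 i)) *+ 2
  + \sum_i (y 0 i - z 0 i) ^+ 2); last first.
  by rewrite -sumrMnl -!big_split/=; apply: eq_bigr => i _; ring.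
by rewrite lerD2r lerD2l lerMn2r.
Qed.

Lemma edist_continuous x : continuous (edist x).
Proof.
move=> y; apply: continuous_comp; last exact: sqrt_continuous.
apply: (@cvg_big _ _ _ _ _ add_continuous _ (nbhs (y : 'rV[R]_d))) => i _.
apply: (@continuous_comp _ _ _ (fun y : 'rV[R]_d => x 0 i - y 0 i) (fun r : R => r ^+ 2)).
  by apply: continuousB; [exact: cst_continuous|exact: coord_continuous].
exact: exprn_continuous.
Qed.

Definition foot A x y := A y /\ forall a, A a -> edist x y <= edist x a.

Lemma foot_set_dist A x y : foot A x y -> set_dist A x = (edist x y)%:E.
Proof.
move=> [Ay xy]; apply/eqP; rewrite eq_le; apply/andP; split.
  by apply: ereal_inf_lbound; exists y.
by apply: le_ereal_inf_tmp => _ [a Aa <-]; rewrite lee_fin xy.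
Qed.

(** Only the points of A no farther from x than a given a in A compete, and they
form a compact set. *)
Lemma foot_exists A x : closed A -> A !=set0 -> exists y, foot A x y.
Proof.
move=> cA [a Aa].
pose K := A `&` [set y | edist x y <= edist x a].
have cK : compact K.
  apply: bounded_closed_compact; last first.
    apply: closedI => //; rewrite (_ : [set _ | _] = edist x @^-1` [set r | r <= edist x a])//.
    apply: closed_comp => [y _|]; first exact: edist_continuous.
    exact: closed_le.
  change (\forall M \near +oo, forall y, K y -> `|y| <= M).
  near=> M => y [_ /= yx].
  rewrite /= [leLHS](mx_normrE y : `|y| = _).
  apply/bigmax_leP; split => [|[i j] _ /=]; first by near: M; exact: nbhs_pinfty_ge.
  rewrite (ord1 i).
  have -> : y 0 j = x 0 j - (x 0 j - y 0 j) by ring.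
  rewrite (le_trans (ler_normB _ _))//.
  apply: (@le_trans _ _ (`|x| + edist x a)).
    apply: lerD; last by rewrite (le_trans (le_coord_edist _ _ _)).
    by rewrite [leRHS](mx_normrE x : `|x| = _) (le_bigmax_cond _ (fun i => `|x i.1 i.2|) (j:=(0,j))).
  by near: M; apply: nbhs_pinfty_ge; exact: num_real.
have [] := @EVT_min_rV _ _ (edist x) K _ cK; first by exists a; split => /=.
  by apply: continuous_subspaceT => ?; exact: edist_continuous.
move=> y; rewrite inE => -[Ay /= yx] ymin; exists y; split => // b Ab.
have [ab|/ltW ba] := leP (edist x b) (edist x a); last exact: le_trans ba.
by apply: ymin; rewrite inE; split.
Unshelve. all: by end_near. Qed.

(** Moving x towards its nearest point y keeps y nearest: a point of A nearer to
z than y would, by the triangle inequality through z, be nearer to x than y. *)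
Lemma foot_segment A x y z s : foot A x y -> 0 <= s <= edist x y ->
  edist z y = s -> edist x z = edist x y - s -> foot A z y.
Proof.
move=> [Ay yx] /andP[s0 sD] zy xz; split => // a Aa.
by have := yx _ Aa; have := edist_triangle z x a; lra.
Qed.

Definition slide s x y : 'rV[R]_d := y + (s / edist x y) *: (x - y).

(** Stated with the scaling hypothesis on coordinates, so that it serves for both
parts into which [slide s x y] cuts the segment. *)
Lemma edist_scale (x y p q : 'rV[R]_d) c :
  (forall i, p 0 i - q 0 i = c * (x 0 i - y 0 i)) -> edist p q = `|c| * edist x y.
Proof.
move=> pq; rewrite /edist -sqrtr_sqr -sqrtrM ?sqr_ge0//; congr Num.sqrt.
by rewrite mulr_sumr; apply: eq_bigr => i _; rewrite pq exprMn.
Qed.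

Lemma edist_slide x y s : 0 <= s -> 0 < edist x y -> edist (slide s x y) y = s.
Proof.
move=> s0 D0; rewrite (@edist_scale x y _ _ (s / edist x y)).
  by rewrite ger0_norm ?divr_ge0 ?edist_ge0// divfK// gt_eqF.
by move=> i; rewrite !mxE; ring.
Qed.

Lemma edist_slide_end x y s : s <= edist x y -> 0 < edist x y ->
  edist x (slide s x y) = edist x y - s.
Proof.
move=> sD D0; rewrite (@edist_scale x y _ _ (1 - s / edist x y)).
  rewrite ger0_norm; last by rewrite subr_ge0 ler_pdivrMr// mul1r.
  by rewrite mulrBl mul1r divfK// gt_eqF.
by move=> i; rewrite !mxE; ring.
Qed.

Lemma passing_slide A x y s : foot A x y -> 0 <= s <= edist x y ->
  0 < edist x y -> passing_set A s (slide s x y).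
Proof.
move=> fxy /andP[s0 sD] D0.
rewrite /passing_set /= (@foot_set_dist _ _ y) ?edist_slide//.
apply: (foot_segment (s := s) fxy); rewrite ?s0 ?edist_slide//.
exact: edist_slide_end.
Qed.

(** Comparison of the unit directions u, u' from feet y, y' to x, x', with z, z'
the points at distance s from the feet. With q = y - y', the inequalities
[|x - y'| >= |x - y|] and [|x' - y| >= |x' - y'|] say
[|q|^2 + 2 D <u, q> >= 0] and [|q|^2 - 2 D' <u', q> >= 0]. Since D and D' are at
least 2s, both remain true with 4s for 2D and 2D', and their sum gives
[|q|^2 + 2s <u - u', q> >= 0]. As z - z' = q + s (u - u'), the left-hand side is
exactly [|z - z'|^2 - s^2 |u - u'|^2]. *)
Lemma foot_direction_Lipschitz A x y x' y' s : foot A x y -> foot A x' y' ->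
  0 < s -> 2 * s <= edist x y -> 2 * s <= edist x' y' ->
  s ^+ 2 * (\sum_i ((x 0 i - y 0 i) / edist x y
                    - (x' 0 i - y' 0 i) / edist x' y') ^+ 2)
    <= edist (slide s x y) (slide s x' y') ^+ 2.
Proof.
move=> [Ay xy] [Ay' xy'] s0 sD sD'.
have := xy _ Ay'; have := xy' _ Ay.
rewrite !le_edistE sqr_edist.
set D := edist x y in sD *; set D' := edist x' y' in sD' *.
pose u i := (x 0 i - y 0 i) / D; pose u' i := (x' 0 i - y' 0 i) / D'.
pose q i := y 0 i - y' 0 i.
have xu i : x 0 i - y 0 i = D * u i by rewrite /u; field; lra.
have xu' i : x' 0 i - y' 0 i = D' * u' i by rewrite /u'; field; lra.
rewrite (_ : \sum_i (x 0 i - y' 0 i) ^+ 2 = \sum_i (x 0 i - y 0 i) ^+ 2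
    + 2 * D * (\sum_i q i * u i) + \sum_i q i ^+ 2); last first.
  rewrite mulr_sumr -!big_split/=; apply: eq_bigr => i _.
  have -> : x 0 i - y' 0 i = D * u i + q i by rewrite -xu /q; ring.
  by rewrite xu; ring.
rewrite (_ : \sum_i (x' 0 i - y 0 i) ^+ 2 = \sum_i (x' 0 i - y' 0 i) ^+ 2
    - 2 * D' * (\sum_i q i * u' i) + \sum_i q i ^+ 2); last first.
  rewrite mulr_sumr -sumrB -!big_split/=; apply: eq_bigr => i _.
  have -> : x' 0 i - y 0 i = D' * u' i - q i by rewrite -xu' /q; ring.
  by rewrite xu'; ring.
rewrite (_ : \sum_i (slide s x y 0 i - slide s x' y' 0 i) ^+ 2 =
    \sum_i q i ^+ 2 + 2 * s * (\sum_i q i * u i) - 2 * s * (\sum_i q i * u' i)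
    + s ^+ 2 * (\sum_i (u i - u' i) ^+ 2)); last first.
  rewrite !mulr_sumr -big_split/= -sumrB -big_split/=; apply: eq_bigr => i _.
  by rewrite !mxE -/D -/D' /q /u /u'; ring.
have : 0 <= \sum_i q i ^+ 2 by apply: sumr_ge0 => i _; exact: sqr_ge0.
set Q := \sum_i q i ^+ 2; set S := \sum_i q i * u i; set S' := \sum_i q i * u' i.
move=> Q0 h2 h1; rewrite -[X in s ^+ 2 * X]/(\sum_i (u i - u' i) ^+ 2).
(* Lowering 2 D to 4 s only matters when the inner product has the bad sign. *)
have k1 : 0 <= Q + 4 * s * S by have [S0|S0] := leP 0 S; nra.
have k2 : 0 <= Q - 4 * s * S' by have [S0|S0] := leP 0 S'; nra.
lra.
Qed.

(** The shell is Lipschitz-parametrised by (z, D): write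
x - x' = (z - z') + (D - s) (u - u') + (D - D') u', where D - s <= 3s, so that
the middle term is at most 3 |z - z'| by [foot_direction_Lipschitz]. *)
Lemma foot_coord_Lipschitz A x y x' y' s i : foot A x y -> foot A x' y' ->
  0 < s -> 2 * s <= edist x y <= 4 * s -> 2 * s <= edist x' y' <= 4 * s ->
  `|x 0 i - x' 0 i| <= 4 * edist (slide s x y) (slide s x' y')
                       + `|edist x y - edist x' y'|.
Proof.
move=> fx fx' s0 /andP[sD Ds] /andP[sD' Ds'].
have := foot_direction_Lipschitz fx fx' s0 sD sD'.
set a := edist (slide s x y) (slide s x' y').
have := le_coord_edist (slide s x y) (slide s x' y') i; rewrite -/a.
have := le_coord_edist x' y' i.
set D := edist x y in sD Ds *; set D' := edist x' y' in sD' Ds' *.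
set u := fun i => (x 0 i - y 0 i) / D.
set u' := fun i => (x' 0 i - y' 0 i) / D'.
move=> u'1 za sb.
have a0 : 0 <= a by exact: edist_ge0.
have ub : s * `|u i - u' i| <= a.
  rewrite -(ler_pXn2r (ltn0Sn 1)) ?nnegrE ?mulr_ge0 ?(ltW s0)//.
  apply: le_trans sb; rewrite exprMn ler_pM2l ?exprn_gt0//.
  rewrite real_normK ?num_real// (bigD1 i)//= lerDl sumr_ge0// => j _.
  exact: sqr_ge0.
have u'i : `|u' i| <= 1.
  have D'0 : 0 < D' by lra.
  by rewrite normrM normfV (gtr0_norm D'0) ler_pdivrMr// mul1r.
have -> : x 0 i - x' 0 i = (slide s x y 0 i - slide s x' y' 0 i)
   + (D - s) * (u i - u' i) + (D - D') * u' i.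
  by rewrite !mxE -/D -/D' /u /u'; field; lra.
have : `|(D - s) * (u i - u' i)| <= 3 * a.
  rewrite normrM ger0_norm; last by lra.
  by have := normr_ge0 (u i - u' i); nra.
have : `|(D - D') * u' i| <= `|D - D'|.
  by rewrite normrM ler_piMr.
move=> h1 h2; rewrite (le_trans (ler_normD _ _))// lerD//.
by rewrite (le_trans (ler_normD _ _))//; lra.
Qed.

End euclidean_distance.

(** * Lebesgue outer measure *)

Section lebesgue_outer.
Variables (R : realType) (d : nat).
Local Notation leb := (lebesgue_rV R d).

Lemma measurable_box (a b : 'rV[R]_d) :
  measurable ([set x : 'rV[R]_d | forall i, a 0 i < x 0 i <= b 0 i]
    : set (borel_rV R d)).
Proof.
rewrite (_ : [set x | _] = \bigcap_(i in [set: 'I_d]) ((fun x : borel_rV R d =>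
    (x : 'rV_d) 0 i) @^-1` `]a 0 i, b 0 i]%classic)).
  apply: fin_bigcap_measurable => // i _; rewrite -[X in measurable X]setTI.
  by apply: coord_measurable => //; exact: measurable_itv.
by apply/seteqP; split=> x Bx i; [move=> _|]; have := Bx i; rewrite /= in_itv/=;
  [|exact].
Qed.

(** The outer measure is used because the pieces into which the shells are cut,
defined through arbitrary covers, need not be Borel. *)
Definition outer_lebesgue : set 'rV[R]_d -> \bar R := mu_ext leb.

Lemma outer_lebesgue_ge0 T : (0 <= outer_lebesgue T)%E.
Proof. exact: mu_ext_ge0. Qed.

Lemma outer_lebesgue0 : outer_lebesgue set0 = 0%E.
Proof. exact: mu_ext0. Qed.

Lemma le_outer_lebesgue T T' : T `<=` T' ->
  (outer_lebesgue T <= outer_lebesgue T')%E.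
Proof. exact: (@le_mu_ext _ (borel_rV R d) _ leb). Qed.

Lemma outer_lebesgueE (T : set (borel_rV R d)) : measurable T ->
  outer_lebesgue T = leb T.
Proof. exact: measurable_mu_extE. Qed.

Lemma outer_lebesgue_bigcup (T : nat -> set 'rV[R]_d) :
  (outer_lebesgue (\bigcup_k T k) <= \sum_(0 <= k <oo) outer_lebesgue (T k))%E.
Proof. by apply: mu_ext_sigma_subadditive; exact: measure_ge0. Qed.

Lemma outer_lebesgue_bigsetU (T : nat -> set 'rV[R]_d) N :
  (outer_lebesgue (\big[setU/set0]_(k < N) T k)
    <= \sum_(k < N) outer_lebesgue (T k))%E.
Proof.
exact: (outer_measure_subadditive
  (mu_ext leb : {outer_measure set (borel_rV R d) -> \bar R})).
Qed.

Lemma outer_lebesgue_le_cube (T : set 'rV[R]_d) (r : R) : 0 < r ->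
  (forall x x', T x -> T x' ->
     forall i, `|x 0 i - x' 0 i| <= r) ->
  (outer_lebesgue T <= ((4 * r) ^+ d)%:E)%E.
Proof.
move=> r0 Tr; have [->|/set0P[c Tc]] := eqVneq T set0.
  by rewrite outer_lebesgue0// lee_fin exprn_ge0// mulr_ge0// ltW.
(* Boxes are open on the left, whence a margin: half-side 2 r, not r. *)
pose a : 'rV[R]_d := \row_i (c 0 i - 2 * r).
pose b : 'rV[R]_d := \row_i (c 0 i + 2 * r).
apply: (@le_trans _ _ (outer_lebesgue
    [set x : 'rV[R]_d | forall i, a 0 i < x 0 i <= b 0 i])).
  apply: le_outer_lebesgue => x Tx i; rewrite !mxE.
  have := Tr _ _ Tx Tc i; rewrite ler_norml => /andP[h1 h2].
  by apply/andP; split; lra.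
rewrite outer_lebesgueE; last exact: measurable_box.
rewrite [leLHS](@lebesgue_rV_box R d a b _); last by move=> i; rewrite !mxE; lra.
rewrite lee_fin (eq_bigr (fun=> 4 * r)); last by move=> i _; rewrite !mxE; ring.
by rewrite prodr_const card_ord.
Qed.

End lebesgue_outer.

(** * Volume of shells and collars *)

Section shells.
Variables (R : realType) (n : nat).
Implicit Types (A U : set 'rV[R]_n.+1).

(** The part of the shell lying above U, for the projection onto the level set at
distance s along shortest segments to A. *)
Definition shell_over A s U : set 'rV[R]_n.+1 :=
  [set x | exists y, [/\ foot A x y, 2 * s <= edist x y <= 4 * s & U (slide s x y)]].

(** Three s / l slabs, each in a cube of side 20 l; see [shell_over_le]. *)
Definition shell_cst : R := 3 * 20 ^+ n.+1.

(** Cut the part of the shell above U into N slabs where the distance to A varies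
by at most l. By [foot_coord_Lipschitz] coordinates vary by at most
4 l + l = 5 l in each slab, which has outer volume at most (20 l)^(n+1). There
are N <= 2 s / l + 1 <= 3 s / l slabs, the last bound using l <= s. *)
Lemma shell_over_le A s U l : 0 < l <= s ->
  (forall z z', U z -> U z' -> edist z z' <= l) ->
  (outer_lebesgue (shell_over A s U) <= (shell_cst * s * l ^+ n)%:E)%E.
Proof.
move=> /andP[l0 ls] Ul.
pose N := (Num.trunc (2 * s / l)).+1.
pose T k : set 'rV[R]_n.+1 := [set x | exists y,
  [/\ foot A x y, 2 * s <= edist x y <= 4 * s, U (slide s x y) &
      2 * s + k%:R * l <= edist x y <= 2 * s + k.+1%:R * l]].
have TN : shell_over A s U `<=` \big[setU/set0]_(k < N) T k.
  move=> x [y [fxy /andP[sD Ds] Us]]; rewrite -bigcup_mkord.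
  have t0 : 0 <= (edist x y - 2 * s) / l.
    by apply: divr_ge0; lra.
  have /andP[k1 k2] := Num.Theory.truncn_itv t0.
  exists (Num.trunc ((edist x y - 2 * s) / l)) => /=.
    rewrite /N ltnS; apply: Num.Theory.le_truncn.
    by rewrite ler_pM2r ?invr_gt0//; lra.
  exists y; split => //; first by rewrite sD.
  move: k1 k2; rewrite ler_pdivlMr// ltr_pdivrMr//.
  by move=> k1 k2; apply/andP; split; lra.
apply: le_trans (le_outer_lebesgue TN) _.
apply: le_trans (outer_lebesgue_bigsetU _ _) _.
apply: (@le_trans _ _ (\sum_(k < N) ((4 * (5 * l)) ^+ n.+1)%:E)%E).
  apply: lee_sum => k _; apply: outer_lebesgue_le_cube; first by rewrite mulr_gt0.
  move=> x x' [y [fxy sD Us kD]] [y' [fxy' sD' Us' kD']] i.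
  have s0 : 0 < s by exact: lt_le_trans ls.
  apply: (le_trans (foot_coord_Lipschitz i fxy fxy' s0 sD sD')).
  have := Ul _ _ Us Us'.
  have : `|edist x y - edist x' y'| <= l.
    move: kD kD'; rewrite -natr1 ler_norml => /andP[? ?] /andP[? ?].
    by apply/andP; split; lra.
  lra.
rewrite sumEFin lee_fin sumr_const card_ord -[leLHS]mulr_natr.
have t0 : 0 <= 2 * s / l by apply: divr_ge0; lra.
have /andP[+ _] := Num.Theory.truncn_itv t0.
rewrite ler_pdivlMr// => Nl.
rewrite (_ : 4 * (5 * l) = 20 * l); last by ring.
rewrite /N -[(Num.trunc _).+1%:R]natr1.
rewrite exprMn [l ^+ n.+1]exprS /shell_cst.
set t := (Num.trunc _)%:R in Nl *.
rewrite (_ : _ * (t + 1) = (20 ^+ n.+1 * l ^+ n) * (t * l + l)); last by ring.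
rewrite (_ : _ * s * _ = (20 ^+ n.+1 * l ^+ n) * (3 * s)); last by ring.
rewrite ler_wpM2l//; last by lra.
by rewrite mulr_ge0// exprn_ge0// ltW.
Qed.

Lemma diam_pow_ge0 r U : (0 <= diam_pow r U)%E.
Proof. by rewrite /diam_pow; case: ifP => // _; exact: poweR_ge0. Qed.

Lemma edist_le_ediam U z z' : U z -> U z' -> ((edist z z')%:E <= ediam U)%E.
Proof.
move=> Uz Uz'; rewrite /ediam le_max; apply/orP; right.
by apply: ereal_sup_ubound; exists (z, z').
Qed.

(** [shell_over_le] needs a positive l, whereas the diameter of U may vanish. Take
l slightly above the diameter; continuity of the power costs an arbitrarily
small e. For n = 0 and U a singleton, 0 ^+ 0 = 1 agrees with the convention
of [diam_pow]. *)
Lemma shell_over_diam_le A s U e : 0 < s -> 0 < e -> (ediam U < s%:E)%E ->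
  (outer_lebesgue (shell_over A s U) <=
   (shell_cst * s)%:E * (diam_pow (n.+1%:R - 1) U + e%:E))%E.
Proof.
move=> s0 e0 Us; have C0 : 0 <= shell_cst * s.
  by rewrite !mulr_ge0 ?exprn_ge0// ltW.
rewrite /diam_pow; case: ifPn => [/eqP ->|_].
  rewrite (_ : shell_over _ _ _ = set0); last by apply/seteqP; split => // x [y []].
  by rewrite outer_lebesgue0; apply: mule_ge0; rewrite ?add0e lee_fin// ltW.
have D0 : (0 <= ediam U)%E by rewrite /ediam le_max lexx.
have Ufin : ediam U \is a fin_num by rewrite ge0_fin_numE// (lt_trans Us)// ltry.
rewrite -(fineK Ufin); set D := fine (ediam U).
have {}D0 : 0 <= D by exact: fine_ge0.
have Ds : D < s by rewrite -lte_fin /D fineK.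
rewrite poweR_EFin -natr1 addrK powR_mulrn//.
have [l [Dl ls le]] : exists l, [/\ D < l, l < s & l ^+ n < D ^+ n + e].
  near D^'+ => l; exists l; split; near: l.
  - exact: nbhs_right_gt.
  - exact: nbhs_right_lt.
  - have : l ^+ n @[l --> D^'+] --> D ^+ n.
      by apply: cvg_at_right_filter; exact: exprn_continuous.
    by move=> /(cvgr_lt (D ^+ n)); apply; rewrite ltrDl.
apply: (le_trans (@shell_over_le _ _ _ l _ _)).
- by rewrite (le_lt_trans D0 Dl) ltW.
- move=> z z' Uz Uz'; rewrite (le_trans _ (ltW Dl))// -lee_fin /D fineK//.
  exact: edist_le_ediam.
- by rewrite -EFinD -EFinM lee_fin ler_wpM2l// ltW.
Unshelve. all: by end_near. Qed.

(** The contents increase to the measure as the bound on the diameters decreases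
to 0, so a bound on the measure provides covers at any chosen fineness. *)
Lemma hausdorff_content_le_measure d r delta (E : set 'rV[R]_d) : 0 < delta ->
  (hausdorff_content r delta E <= hausdorff_measure r E)%E.
Proof.
move=> d0; apply: lime_ge; first by apply/cvg_ex; eexists; exact: cvg_hausdorff_measure.
near=> x; apply: hausdorff_content_le; near: x.
exact: nbhs_right_le.
Unshelve. all: by end_near. Qed.

(** Every point of the shell lies above a point of [passing_set A s], hence above
some member of a cover of that set. The sum over a cover with diameters below s
is less than M, and the errors e of [shell_over_diam_le], chosen as
M / 2^(i+1), add up to at most M: this is the factor 2. *)
Lemma shell_le A s M : 0 < s ->
  (hausdorff_measure (n.+1%:R - 1) (passing_set A s) < M%:E)%E ->
  (outer_lebesgue (shell_over A s setT) <= (2 * shell_cst * M * s)%:E)%E.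
Proof.
move=> s0 /(le_lt_trans (hausdorff_content_le_measure _ _ s0))/ereal_inf_lt.
move=> [_ [U [PU Us] <-] UM].
have M0 : 0 < M.
  rewrite -lte_fin (le_lt_trans _ UM)// nneseries_ge0// => i _ _.
  exact: diam_pow_ge0.
have sub : shell_over A s setT `<=` \bigcup_i shell_over A s (U i).
  move=> x [y [fxy sD _]].
  have [i _ Ui] : (\bigcup_i U i) (slide s x y).
    by apply: PU; apply: passing_slide fxy _ _; lra.
  by exists i => //; exists y.
apply: le_trans (le_outer_lebesgue sub) _.
apply: le_trans (outer_lebesgue_bigcup _) _.
apply: (@le_trans _ _ (\sum_(0 <= i <oo) (shell_cst * s)%:E *
    (diam_pow (n.+1%:R - 1) (U i) + (M / (2 ^ i.+1)%:R)%:E))%E).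
  apply: lee_nneseries => [i _ _|i _]; first exact: outer_lebesgue_ge0.
  by apply: shell_over_diam_le => //; rewrite divr_gt0.
rewrite nneseriesZl; last first.
  by move=> i _; rewrite adde_ge0 ?diam_pow_ge0// lee_fin divr_ge0// ltW.
apply: (@le_trans _ _ ((shell_cst * s)%:E * (M%:E + M%:E))%E).
  apply: lee_wpmul2l; first by rewrite lee_fin !mulr_ge0 ?exprn_ge0// ltW.
  apply: (le_trans (epsilon_trick _ _ _)); [|exact: ltW|].
    by move=> i; exact: diam_pow_ge0.
  by rewrite leeD2r// ltW.
by rewrite -EFinD -EFinM lee_fin; lra.
Qed.

Lemma dyadic_scale (a x : R) : 0 < x < a ->
  exists k, a / 2 ^+ k.+1 <= x <= a / 2 ^+ k.
Proof.
move=> /andP[x0 xa].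
have ex : exists k, a / 2 ^+ k.+1 <= x.
  exists (Num.bound (a / x)); rewrite ler_pdivrMr ?exprn_gt0// -ler_pdivrMl// mulrC.
  apply: ltW; apply: upper_nthrootP; exact: leqnSn.
case: (ex_minnP ex) => k kx kmin; exists k; rewrite kx/=.
case: k kx kmin => [|k] kx kmin; first by rewrite expr0 divr1 ltW.
by rewrite leNgt; apply/negP => /ltW/kmin; rewrite ltnn.
Qed.

(** Sum [shell_le] over the scales s_k = delta / 2^(k+2), whose shells [[2 s_k, 4 s_k]]
are the dyadic intervals [[delta / 2^(k+1), delta / 2^k]] and whose total is
delta / 2. *)
Lemma collar_le A delta M : 0 < delta ->
  (forall t, 0 < t < delta ->
     (hausdorff_measure (n.+1%:R - 1) (passing_set A t) < M%:E)%E) ->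
  (outer_lebesgue [set x | exists y, foot A x y /\ (0 < edist x y < delta)%R] <=
    (shell_cst * M * delta)%:E)%E.
Proof.
move=> d0 HM.
pose s k := delta / 2 / 2 ^+ k.+1.
have s0 k : 0 < s k < delta.
  rewrite /s; apply/andP; split; first by rewrite !divr_gt0// exprn_gt0.
  rewrite ltr_pdivrMr ?exprn_gt0// ltr_pdivrMr// -mulrA ltr_pMr//.
  have : 1 <= 2 ^+ k.+1 :> R by apply: exprn_ege1; lra.
  lra.
have sub : [set x | exists y, foot A x y /\ (0 < edist x y < delta)%R] `<=`
    \bigcup_k shell_over A (s k) setT.
  move=> x [y [fxy /dyadic_scale[k /andP[k1 k2]]]]; exists k => //; exists y.
  split => //; apply/andP; split.
    by rewrite (le_trans _ k1)// /s; lra.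
  rewrite (le_trans k2)// /s exprS; rewrite le_eqVlt; apply/predU1P; left.
  by field; rewrite expf_neq0.
apply: le_trans (le_outer_lebesgue sub) _.
apply: le_trans (outer_lebesgue_bigcup _) _.
pose e := shell_cst * M * delta.
have M0 : 0 <= M.
  have /HM : 0 < delta / 2 < delta by apply/andP; split; lra.
  move=> /(le_lt_trans (hausdorff_content_le_measure _ _ ltr01)) h.
  rewrite -lee_fin ltW// (le_lt_trans _ h)//.
  apply: le_ereal_inf_tmp => _ [U _ <-]; apply: nneseries_ge0 => i _ _.
  exact: diam_pow_ge0.
apply: (@le_trans _ _ (\sum_(0 <= i <oo) (e / (2 ^ i.+1)%:R)%:E)%E).
  apply: lee_nneseries => [i _ _|i _]; first exact: outer_lebesgue_ge0.
  have /andP[si0 _] := s0 i.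
  apply: le_trans (shell_le si0 (HM _ (s0 i))) _.
  rewrite lee_fin natrX /e /s; rewrite le_eqVlt; apply/predU1P; left; field.
  by rewrite expf_neq0.
by apply: epsilon_trick0; rewrite /e !mulr_ge0 ?exprn_ge0// ltW.
Qed.

End shells.

(** * Mass of the collar *)

Section collar.
Variables (R : realType) (d : nat).
Implicit Types (A : set 'rV[R]_d).

Lemma set_dist_lt A x delta : (set_dist A x < delta%:E)%E <->
  exists2 y, A y & edist x y < delta.
Proof.
split => [/ereal_inf_lt[_ [y Ay <-]]|[y Ay xy]]; first by exists y.
by apply: (@le_lt_trans _ _ (edist x y)%:E) => //; apply: ereal_inf_lbound; exists y.
Qed.

Lemma le_thickening A (a b : R) : a <= b -> thickening A a `<=` thickening A b.
Proof. by move=> ab x /= xa; apply: lt_le_trans xa _; rewrite lee_fin. Qed.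

Lemma open_thickening A delta : open (thickening A delta).
Proof.
rewrite (_ : thickening A delta = \bigcup_(y in A) (edist y @^-1` [set r | r < delta])).
  apply: bigcup_open => y _; apply: open_comp => [x _|]; first exact: edist_continuous.
  exact: open_lt.
apply/seteqP; split => [x /set_dist_lt[y Ay xy]|x [y Ay /= xy]].
  by exists y => //=; rewrite edistC.
by apply/set_dist_lt; exists y => //; rewrite edistC.
Qed.

Lemma open_measurable_rV (U : set 'rV[R]_d) : open U ->
  measurable (U : set (borel_rV R d)).
Proof. exact: sub_sigma_algebra. Qed.

Lemma closed_measurable_rV A : closed A -> measurable (A : set (borel_rV R d)).
Proof.
by move=> cA; rewrite -[A]setCK; apply: measurableC; apply: open_measurable_rV; exact: closed_openC.
Qed.

Lemma measurable_collar A delta : closed A ->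
  measurable ((thickening A delta `\` A) : set (borel_rV R d)).
Proof.
move=> cA; apply: measurableD; last exact: closed_measurable_rV.
by apply: open_measurable_rV; exact: (@open_thickening A delta).
Qed.

Lemma collar_foot A delta x : closed A -> (thickening A delta `\` A) x ->
  exists y, foot A x y /\ 0 < edist x y < delta.
Proof.
move=> cA [/set_dist_lt[a Aa xa] nAx].
have [|y fxy] := foot_exists x cA; first by exists a.
exists y; split => //; have [Ay yx] := fxy; apply/andP; split.
  rewrite lt_neqAle edist_ge0 andbT eq_sym; apply/eqP => /edist_eq0 xy.
  by apply: nAx; rewrite xy.
exact: le_lt_trans (yx _ Aa) xa.
Qed.

Lemma levy_prokhorov_ge0 (F G : probability (borel_rV R d) R) :
  (0 <= levy_prokhorov F G)%E.
Proof. by apply: le_ereal_inf_tmp => _ [e [e0 _] <-]; rewrite lee_fin ltW. Qed.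

(** For some e < delta, the defining inequality of the Levy-Prokhorov distance at A
gives F A <= G (A^e) + e, where A^e is contained in the union of A and its
collar of width delta; subtract G A. *)
Lemma collar_mass (F G : probability (borel_rV R d) R) A eps delta :
  tv_attained F G A -> (eps%:E <= tv_dist F G)%E ->
  (levy_prokhorov F G < delta%:E)%E ->
  ((eps - delta)%:E <= G (thickening A delta `\` A))%E.
Proof.
move=> [cA ->] epsFG /ereal_inf_lt[_ [e [e0 /(_ A (closed_measurable_rV cA))[FGe _]] <-]].
rewrite lte_fin => ed.
have mA := closed_measurable_rV cA.
have mTe := open_measurable_rV (@open_thickening A e).
have mD := measurable_collar delta cA.
have FA := fin_num_measure F _ mA; have GA := fin_num_measure G _ mA.
have GT := fin_num_measure G _ mTe; have GD := fin_num_measure G _ mD.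
have GTe : (G (thickening A e) <= G A + G (thickening A delta `\` A))%E.
  apply: (@le_trans _ _ (G (A `|` (thickening A delta `\` A)))); last exact: measureU2.
  apply: le_measure; rewrite ?inE//; first exact: measurableU.
  move=> x /(le_thickening (ltW ed)) xT.
  by have [Ax|nAx] := pselect (A x); [left|right].
move: epsFG FGe GTe.
rewrite -(fineK FA) -(fineK GA) -(fineK GT) -(fineK GD) -!EFinB -!EFinD !lee_fin.
lra.
Qed.

Lemma density_abs_continuous g (G : probability (borel_rV R d) R) eps :
  is_density g G -> 0 < eps ->
  exists2 eta, 0 < eta & forall B : set (borel_rV R d), measurable B ->
    (lebesgue_rV R d B < eta%:E)%E -> (G B < eps%:E)%E.
Proof.
move=> [mg g0 Gg] eps0.
have ig : (lebesgue_rV R d).-integrable setT (EFin \o g).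
  apply/integrableP; split; first exact/measurable_realfun.measurable_EFinP.
  under eq_integral do rewrite /= ger0_norm//.
  by rewrite -Gg// probability_setT ltry.
have [eta [eta0 He]] := integral_normr_continuous ig eps0.
exists eta => // B mB /(He _ mB).
have -> : \int[lebesgue_rV R d]_(x in B) `|g x| = fine (G B).
  rewrite /Rintegral Gg//; congr fine; apply: eq_integral => x _.
  by rewrite ger0_norm.
by rewrite -lte_fin fineK// fin_num_measure.
Qed.

End collar.

(** * Large level sets *)

(** Otherwise [collar_le] would give the collar a volume of at most eta / 2. *)
Lemma passing_set_large (R : realType) n (A : set 'rV[R]_n.+1) delta eta :
  closed A -> 0 < delta -> 0 < eta ->
  (eta%:E <= lebesgue_rV R n.+1 (thickening A delta `\` A))%E ->
  exists2 t, 0 < t < delta &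
    ((eta / (2 * shell_cst R n * delta))%:E
       <= hausdorff_measure (n.+1%:R - 1) (passing_set A t))%E.
Proof.
move=> cA d0 eta0 etaA; set M := eta / _.
have C0 : 0 < shell_cst R n by rewrite mulr_gt0// exprn_gt0.
apply: contrapT => nt.
have HM t : 0 < t < delta ->
    (hausdorff_measure (n.+1%:R - 1) (passing_set A t) < M%:E)%E.
  by move=> t0; rewrite ltNge; apply/negP => Mt; apply: nt; exists t.
have := collar_le d0 HM; apply/negP; rewrite -ltNge.
apply: (@lt_le_trans _ _ eta%:E).
  rewrite lte_fin (_ : _ * _ * _ = eta / 2); first by lra.
  by rewrite /M; field; rewrite !gt_eqF.
apply: le_trans etaA _.
rewrite -outer_lebesgueE; last exact: measurable_collar.
by apply: le_outer_lebesgue => x /(collar_foot cA).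
Qed.

Unset Implicit Arguments.

Theorem theorem1 (R : realType) (d : nat) (hd : (1 <= d)%N)
  (g : borel_rV R d -> R) (f : nat -> borel_rV R d -> R)
  (G : probability (borel_rV R d) R)
  (F : nat -> probability (borel_rV R d) R)
  (hg : is_density g G) (hf : forall j, is_density (f j) (F j))
  (hreg : forall j, tv_regular (F j) G)
  (A : nat -> set 'rV[R]_d) (hA : forall j, tv_attained (F j) G (A j))
  (eps : R) (heps : 0 < eps)
  (hi : forall j, (eps%:E <= tv_dist (F j) G)%E)
  (hii : levy_prokhorov (F j) G @[j --> \oo] --> 0%E)
  (delta : nat -> R)
  (hdelta : forall j, (levy_prokhorov (F j) G < (delta j)%:E)%E)
  (hdelta0 : delta j @[j --> \oo] --> 0) :
  exists t : nat -> R,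
    (forall j, 0 < t j < delta j) /\
    hausdorff_measure (d%:R - 1) (passing_set (A j) (t j)) @[j --> \oo]
      --> +oo%E.
Proof.
case: d hd g f G F hg hf hreg A hA hi hii hdelta => // n _.
move=> g f G F hg _ _ A hA hi _ hdelta.
have eps20 : 0 < eps / 2 by lra.
have [eta eta0 Geta] := density_abs_continuous hg eps20.
have d0 j : 0 < delta j.
  by rewrite -lte_fin (le_lt_trans _ (hdelta j))// levy_prokhorov_ge0.
have C0 : 0 < shell_cst R n by rewrite mulr_gt0// exprn_gt0.
have /choice[t tP] : forall j, exists t, 0 < t < delta j /\ (delta j < eps / 2 ->
    ((eta / (2 * shell_cst R n * delta j))%:E
       <= hausdorff_measure (n.+1%:R - 1) (passing_set (A j) t))%E).
  (* For the finitely many j with delta_j >= eps / 2 any t_j will do. *)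
  move=> j; have [small|large] := ltP (delta j) (eps / 2); last first.
    by exists (delta j / 2); have := d0 j; split => //; apply/andP; split; lra.
  have [cA _] := hA j.
  have [|t t0 Ht] := passing_set_large cA (d0 j) eta0; last by exists t.
  rewrite leNgt; apply/negP => /(Geta _ (measurable_collar _ cA)).
  apply/negP; rewrite -leNgt.
  apply: le_trans (collar_mass (hA j) (hi j) (hdelta j)).
  by rewrite lee_fin; lra.
exists t; split => [j|]; first by have [] := tP j.
apply/cvgeyPge => M.
(* delta_j < eta / K makes eta / (2 C delta_j) exceed |M| + 1. *)
pose K := 2 * shell_cst R n * (`|M| + 1).
have K0 : 0 < K by rewrite !mulr_gt0// ltr_wpDl.
near=> j; have [_ large] := tP j.
have small : delta j < eps / 2 by near: j; apply: (cvgr_lt 0 hdelta0).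
apply: le_trans (large small); rewrite lee_fin.
have dj : delta j < eta / K.
  by near: j; apply: (cvgr_lt 0 hdelta0); exact: divr_gt0.
rewrite ler_pdivlMr; last by rewrite !mulr_gt0.
move: dj; rewrite ltr_pdivlMr// => /ltW; apply: le_trans.
rewrite /K.
have := ler_norm M; have := d0 j; move: (shell_cst R n) C0 => c c0 dj0 hM.
rewrite (_ : M * _ = (2 * c * delta j) * M); last by ring.
rewrite (_ : delta j * _ = (2 * c * delta j) * (`|M| + 1)); last by ring.
by rewrite ler_wpM2l// ?mulr_ge0 ?ltW//; lra.
Unshelve. all: by end_near. Qed.
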